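(* There exists a universal constant $c\in(0,\infty)$ with the following property. Let $\Gamma$ be an Abelian group of cardinality $n$, let $\varepsilon>0$, and let $k\in\mathbb{N}$ satisfy $k\ge \frac{c\log n}{\varepsilon^2}$. Choose $g_1,\ldots,g_k$ independently and uniformly at random from $\Gamma$, and let $G=(V,E)$ be the Cayley graph associated to $g_1,\ldots,g_k$. Then with probability at least $\frac12$, every $S\subseteq\Gamma$ with $2\le |S|\le \frac n2$ satisfies $$\left|\frac{E_G(S,V\setminus S)}{\frac{2k}{n}|S|(n-|S|)}-1\right|\le \varepsilon\sqrt{\frac{\log|S|}{\log n}}.$$
   Context: Graphs may have multiple edges and self loops. For a finite group $\Gamma$ and $g_1,\ldots,g_k\in\Gamma$, the Cayley graph associated to $g_1,\ldots,g_k$ is the $2k$-regular graph with vertex set $V=\Gamma$ in which the number of edges joining $u,v\in\Gamma$ equals $|\{i\in\{1,\ldots,k\}: uv^{-1}=g_i\}|+|\{i\in\{1,\ldots,k\}: uv^{-1}=g_i^{-1}\}|$. For $S\subseteq V$, $E_G(S,V\setminus S)$ denotes the number of edges joining a vertex of $S$ to a vertex of $V\setminus S$. *)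

(* Defs.v *)
From HB Require Import structures.
From mathcomp Require Import all_boot all_order all_algebra all_fingroup.
From mathcomp Require Import reals exp.

Set Implicit Arguments.
Unset Strict Implicit.
Unset Printing Implicit Defensive.

Import Order.TTheory GRing.Theory Num.Theory.

(* Undirected graphs on V with multiple edges and self loops, given by the
   number of edges joining each pair of vertices. *)
Record multigraph (V : finType) := Multigraph {
  edge_mult :> V -> V -> nat;
  edge_multC : forall u v : V, edge_mult u v = edge_mult v u
}.

(* Each edge is counted exactly once when S and T are disjoint, which is the
   only case of interest: T = ~: S. *)
Definition edges_between (V : finType) (G : multigraph V) (S T : {set V}) : nat :=
  \sum_(u in S) \sum_(v in T) G u v.

Section Cayley.
Variables (gT : finGroupType) (k : nat) (g : {ffun 'I_k -> gT}).

Definition cayley_mult (u v : gT) : nat :=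
  #|[set i : 'I_k | (u * v^-1)%g == g i]| +
  #|[set i : 'I_k | (u * v^-1)%g == (g i)^-1%g]|.

Lemma cayley_multC (u v : gT) : cayley_mult u v = cayley_mult v u.
Proof.
have E (x y : gT) : [set i | (x * y^-1)%g == (g i)^-1%g]
                  = [set i | (y * x^-1)%g == g i].
  by apply/setP => i; rewrite !inE -(inj_eq invg_inj) invMg !invgK.
by rewrite /cayley_mult (E u v) (E v u) addnC.
Qed.

Definition cayley_graph : multigraph gT := Multigraph cayley_multC.

Lemma cayley_regular (u : gT) : \sum_(v : gT) cayley_graph u v = (2 * k)%N.
Proof.
have F (h : 'I_k -> gT) :
    \sum_(v : gT) #|[set i : 'I_k | (u * v^-1)%g == h i]| = k.
  transitivity (\sum_(v : gT) \sum_(i < k) (v == ((h i)^-1 * u)%g)).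
    apply: eq_bigr => v _; rewrite -sum1_card big_mkcond /=.
    apply: eq_bigr => i _; rewrite inE.
    suff -> : ((u * v^-1)%g == h i) = (v == ((h i)^-1 * u)%g) by case: eqP.
    by apply/eqP/eqP => [<- | ->]; rewrite ?invMg ?invgK ?mulgKV ?mulKVg.
  rewrite exchange_big /= -[RHS]card_ord -sum1_card; apply: eq_bigr => i _.
  by rewrite (bigD1 ((h i)^-1 * u)%g) //= eqxx big1 // => v /negPf ->.
by rewrite big_split /= !F mul2n addnn.
Qed.
End Cayley.

Local Open Scope ring_scope.

(* Probability of the event A under the uniform distribution on T.  For
   T = {ffun 'I_k -> gT} the coordinates are independent and uniform on gT. *)
Definition uniform_pr (R : realType) (T : finType) (A : {set T}) : R :=
  #|A|%:R / #|T|%:R.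

(* Main.v *)
Require Import Defs.
From mathcomp Require Import all_boot all_order all_algebra all_fingroup.
From mathcomp Require Import reals exp.
From mathcomp Require Import ring lra zify.

Import Order.TTheory GRing.Theory Num.Theory.
Local Open Scope ring_scope.

(** Put [A f x = \sum_j f (a_j x)], where [a_j] ranges over the [g_i] and their
    inverses, and [v = 1_S - |S| / n].  Then [E (S, ~: S)] differs from
    [2 k |S| (n - |S|) / n] by [<v, A v>].  Since [A] is self-adjoint,
    [<v, A v> ^ (2 m) <= |v| ^ (2 (2 m - 1)) |A^m v| ^ 2], and since [A]
    commutes with right translations, the triangle inequality gives
    [|A^m v| ^ 2 <= |S| ^ 2 K_m] with [K_m = |A^m (delta_1 - 1 / n)| ^ 2].
    Now [K_m] is the number of words of length [2 m] in the [a_j] with trivial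
    value, minus [(2 k) ^ (2 m) / n].  A word in which some [g_i] occurs exactly
    once has a uniform value, so it contributes nothing on average; there are at
    most [(16 k m) ^ m] other words.  By Markov's inequality and a union bound,
    [K_m <= (48 k m) ^ m] for all [1 <= m <= n] with probability at least [1/2].
    Taking [m] of order [log |S|], the loss [|S| ^ (1 / m)] is a constant. *)

(** * Inner products on functions over a finite set *)

Definition dot {R : realFieldType} {T : finType} (f h : T -> R) : R :=
  \sum_x f x * h x.

Lemma dot_ge0 (R : realFieldType) (T : finType) (f : T -> R) : 0 <= dot f f.
Proof. by apply: sumr_ge0 => x _; rewrite -expr2 sqr_ge0. Qed.

(** Lagrange's identity: the defect is half the sum of the squared 2 by 2 minors. *)
Lemma dot_cauchy_schwarz (R : realFieldType) (T : finType) (f h : T -> R) :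
  dot f h ^+ 2 <= dot f f * dot h h.
Proof.
have E : dot f f * dot h h - dot f h ^+ 2
       = 2^-1 * \sum_x \sum_y (f x * h y - f y * h x) ^+ 2.
  have -> : \sum_x \sum_y (f x * h y - f y * h x) ^+ 2 =
     \sum_x \sum_y ((f x * f x) * (h y * h y) + (h x * h x) * (f y * f y)
        - 2 * ((f x * h x) * (f y * h y))).
    by apply: eq_bigr => x _; apply: eq_bigr => y _; ring.
  have -> : \sum_x \sum_y ((f x * f x) * (h y * h y) + (h x * h x) * (f y * f y)
        - 2 * ((f x * h x) * (f y * h y))) =
     dot f f * dot h h + dot h h * dot f f - 2 * (dot f h * dot f h).
    rewrite /dot !big_distrlr /= !mulr_sumr -big_split -sumrB /=.
    apply: eq_bigr => x _; rewrite mulr_sumr -big_split -sumrB /=.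
    by apply: eq_bigr.
  by field.
by rewrite -subr_ge0 E mulr_ge0 ?invr_ge0 // sumr_ge0 // => x _;
  apply: sumr_ge0 => y _; apply: sqr_ge0.
Qed.

Lemma sqr_sum_le_card (R : realFieldType) (T : finType) (S : {set T})
    (F : T -> R) :
  (\sum_(x in S) F x) ^+ 2 <= #|S|%:R * \sum_(x in S) F x ^+ 2.
Proof.
have -> : \sum_(x in S) F x
    = dot (fun x => (x \in S)%:R) (fun x => (x \in S)%:R * F x).
  rewrite /dot big_mkcond /=; apply: eq_bigr => x _.
  by case: (x \in S); rewrite ?mul1r ?mul0r.
apply: (le_trans (dot_cauchy_schwarz _ _ _ _)).
rewrite le_eqVlt; apply/orP; left; apply/eqP; congr (_ * _).
  by rewrite -sum1_card natr_sum [RHS]big_mkcond /=; apply: eq_bigr => x _;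
    case: (x \in S); rewrite ?mul1r ?mul0r.
rewrite /dot [RHS]big_mkcond /=; apply: eq_bigr => x _.
by case: (x \in S); rewrite ?mul1r ?mul0r ?expr2.
Qed.

(** * Powers of a self-adjoint operator *)

Section Selfadjoint.
Variables (R : realFieldType) (T : finType) (A : (T -> R) -> T -> R).
Hypothesis Asym : forall f h, dot (A f) h = dot f (A h).

Lemma dot_iter_sym m (f h : T -> R) : dot (iter m A f) h = dot f (iter m A h).
Proof. by elim: m f h => // m IH f h; rewrite iterS Asym IH -iterSr. Qed.

(* Log-convexity of [m |-> c m := |A^m v|^2]: the ratios [c (m+1) / c m]
   increase, and start at [c 1 / c 0 >= (<v, A v> / |v|^2)^2]. *)
Lemma dot_selfadjoint_pow (v : T -> R) (m : nat) :
  dot v (A v) ^+ (2 * m.+1)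
  <= dot v v ^+ (2 * m).+1 * dot (iter m.+1 A v) (iter m.+1 A v).
Proof.
pose c j := dot (iter j A v) (iter j A v).
have c0 j : 0 <= c j by apply: dot_ge0.
have conv j : c j.+1 ^+ 2 <= c j * c j.+2.
  have -> : c j.+1 = dot (iter j A v) (iter j.+2 A v).
    by rewrite /c [in LHS]iterS Asym.
  exact: dot_cauchy_schwarz.
have ratio j : c 1%N * c j <= c 0%N * c j.+1.
  elim: j => [|j IH]; first by rewrite mulrC.
  (* The case of a vanishing [c j.+1] is split off because the induction cancels that factor. *)
  have := c0 j.+1; rewrite le_eqVlt => /orP[/eqP <-|cj].
    by rewrite mulr0 mulr_ge0.
  rewrite -(ler_pM2r cj) -mulrA -expr2.
  apply: (le_trans (ler_wpM2l (c0 1%N) (conv j))).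
  by rewrite mulrA [leRHS]mulrAC; apply: ler_wpM2r.
have pow j : c 1%N ^+ j.+1 <= c 0%N ^+ j * c j.+1.
  elim: j => [|j IH]; first by rewrite mul1r.
  rewrite exprS; apply: (le_trans (ler_wpM2l (c0 1%N) IH)).
  by rewrite mulrCA exprSr -mulrA ler_wpM2l ?exprn_ge0.
rewrite exprM; apply: (@le_trans _ _ ((c 0%N * c 1%N) ^+ m.+1)).
  by rewrite lerXn2r ?nnegrE ?sqr_ge0 ?mulr_ge0 // dot_cauchy_schwarz.
rewrite exprMn; apply: (le_trans (ler_wpM2l (exprn_ge0 _ (c0 0%N)) (pow m))).
by rewrite mulrA -exprD; have -> : (m.+1 + m = (2 * m).+1)%N by lia.
Qed.
End Selfadjoint.

(** * Random words in the generators *)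

Lemma sum_cons_tuple (V : nmodType) (J : finType) (m : nat) (F : seq J -> V) :
  \sum_(w : m.+1.-tuple J) F w = \sum_j \sum_(w : m.-tuple J) F (j :: w).
Proof.
rewrite pair_big /=.
rewrite (reindex (fun p : J * m.-tuple J => cons_tuple p.1 p.2)) //=.
exists (fun w : m.+1.-tuple J => (thead w, behead_tuple w)).
  by move=> [j w] _; congr (_, _) => //; apply: val_inj.
by move=> w _ /=; rewrite [RHS]tuple_eta; apply: val_inj.
Qed.

Section Walk.
Context {gT : finGroupType} {k : nat}.
Implicit Types (g : {ffun 'I_k -> gT}) (j : 'I_k * bool).
Implicit Types (w : seq ('I_k * bool)).

(** Indexing by ['I_k * bool] keeps all 2k letters apart, so repeated generators and involutions
    count with multiplicity, as in [cayley_mult]. *)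
Definition letter g j : gT := if j.2 then g j.1 else (g j.1)^-1%g.

(** The head of the list multiplies on the right: in an iterate, the outermost [adjacency] meets the
    argument first. *)
Definition word g w : gT := foldr (fun j x => (x * letter g j)%g) 1%g w.

Definition adjacency {R : realFieldType} g (f : gT -> R) (x : gT) : R :=
  \sum_j f (letter g j * x)%g.

(** Translation by a letter has translation by its inverse as adjoint, and inverting letters
    permutes the index set. *)
Lemma adjacency_sym (R : realFieldType) g (f h : gT -> R) :
  dot (adjacency g f) h = dot f (adjacency g h).
Proof.
rewrite /dot /adjacency.
under eq_bigr do rewrite mulr_suml.
under [RHS]eq_bigr do rewrite mulr_sumr.
rewrite exchange_big [RHS]exchange_big /=.
rewrite [RHS](reindex_inj (h := fun j => (j.1, ~~ j.2))) /=; last first.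
  by move=> [i b] [i' b'] /= [-> /negb_inj ->].
apply: eq_bigr => j _; rewrite (reindex_inj (mulgI (letter g j)^-1%g)) /=.
apply: eq_bigr => x _; rewrite mulKVg; congr (_ * h (_ * _)%g).
by rewrite /letter; case: j.2; rewrite ?invgK.
Qed.

Lemma iter_adjacency (R : realFieldType) g m (f : gT -> R) x :
  iter m (adjacency g) f x = \sum_(w : m.-tuple _) f (word g w * x)%g.
Proof.
elim: m x => [|m IH] x.
  rewrite (big_pred1 [tuple]) /= ?mul1g // => w.
  by apply/esym/eqP; apply: tuple0.
rewrite (sum_cons_tuple _ _ _ (fun w => f (word g w * x)%g)) iterS /adjacency.
by apply: eq_bigr => j _; rewrite IH; apply: eq_bigr => w _; rewrite /= mulgA.
Qed.

Definition centered_delta {R : realFieldType} (x : gT) : R :=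
  (x == 1%g)%:R - #|gT|%:R^-1.

Lemma cardG_neq0 (R : realFieldType) : (#|gT|%:R : R) != 0.
Proof. by rewrite pnatr_eq0 -lt0n; apply/card_gt0P; exists 1%g. Qed.

Lemma sum_centered_delta (R : realFieldType) :
  \sum_x centered_delta x = 0 :> R.
Proof.
rewrite sumrB (bigD1 1%g) //= eqxx big1 => [|x /negPf -> //].
by rewrite addr0 sumr_const -[_ *+ #|_|]mulr_natr mulVf ?subrr ?cardG_neq0.
Qed.

(** The translate has sum zero, hence is orthogonal to constants; only its value at 1 survives. *)
Lemma dot_centered_delta_translate (R : realFieldType) (u : gT) :
  dot centered_delta (fun x => centered_delta (u * x)%g)
  = centered_delta u :> R.
Proof.
rewrite /dot {1}/centered_delta.
under eq_bigr do rewrite mulrBl.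
rewrite sumrB -mulr_sumr.
rewrite -(reindex_inj (P := xpredT) (F := centered_delta) (mulgI u)) /=.
rewrite sum_centered_delta mulr0 subr0.
rewrite (bigD1 1%g) //= eqxx mulg1 mul1r big1 ?addr0 // => x /negPf ->.
by rewrite mul0r.
Qed.

(* The excess over [1 / #|gT|], times [(2 k) ^ (2 m)], of the return
   probability of the simple random walk after [2 m] steps. *)
Definition walk_energy {R : realFieldType} g m : R :=
  dot (iter m (adjacency g) centered_delta)
      (iter m (adjacency g) centered_delta).

(** Self-adjointness moves all steps to one side, leaving a sum over words that can be averaged over
    [g] word by word. *)
Lemma walk_energyE (R : realFieldType) g m :
  walk_energy g m = \sum_(w : (m + m).-tuple _) centered_delta (word g w) :> R.
Proof.
rewrite /walk_energy (dot_iter_sym _ _ _ (adjacency_sym R g)) -iterD.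
transitivity (\sum_(w : (m + m).-tuple _)
  dot (centered_delta : _ -> R) (fun x => centered_delta (word g w * x)%g)).
  rewrite exchange_big; apply: eq_bigr => x _.
  by rewrite iter_adjacency mulr_sumr.
by apply: eq_bigr => w _; apply: dot_centered_delta_translate.
Qed.

Definition update g (i : 'I_k) (h : gT) : {ffun 'I_k -> gT} :=
  [ffun i' => if i' == i then h else g i'].

(** Exchanging coordinate [i] of [g] with [h] is an involution on pairs, so resampling one
    coordinate preserves the uniform distribution. *)
Lemma sum_update (V : nmodType) (i : 'I_k) (F : {ffun 'I_k -> gT} -> V) :
  (\sum_g F g) *+ #|gT| = \sum_g \sum_h F (update g i h).
Proof.
have inv : involutive (fun p : {ffun 'I_k -> gT} * gT =>
    (update p.1 i p.2, p.1 i)).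
  move=> [g h] /=; rewrite ffunE eqxx; congr (_, _).
  by apply/ffunP => i'; rewrite !ffunE; case: eqP => [->|].
rewrite pair_big /=.
rewrite -(reindex_inj (P := xpredT) (F := fun p => F p.1) (inv_inj inv)) /=.
rewrite -(pair_big xpredT xpredT (fun g _ => F g)) /=.
by rewrite -sumrMnl; apply: eq_bigr => g _; rewrite sumr_const.
Qed.

Lemma word_update_notin g i w h :
  count (fun j => j.1 == i) w = 0%N -> word (update g i h) w = word g w.
Proof.
elim: w => //= j w IH; case: eqP => // /eqP/negPf ji; rewrite add0n => /IH ->.
by rewrite /letter ffunE ji.
Qed.

(** The word is [a * h * b] or [a * h^-1 * b] with [a] and [b] independent of [h]. *)
Lemma word_update_inj g i w :
  count (fun j => j.1 == i) w = 1%N ->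
  injective (fun h => word (update g i h) w).
Proof.
elim: w => //= j w IH; case: eqP => [ji [w0]|/eqP/negPf ji].
  move=> h h' /=; rewrite !word_update_notin // => /mulgI.
  by rewrite /letter !ffunE ji eqxx; case: j.2 => // /invg_inj.
rewrite add0n => /IH inj h h' /=; rewrite /letter !ffunE ji => /mulIg.
exact: inj.
Qed.

(** Resampling [g i] makes the word run through the group once, and [centered_delta] has sum
    zero. *)
Lemma sum_word_singleton (R : realFieldType) i w :
  count (fun j => j.1 == i) w = 1%N ->
  \sum_g centered_delta (word g w) = 0 :> R.
Proof.
move=> w1; apply/eqP.
have := sum_update _ i (fun g => centered_delta (word g w) : R).
rewrite [RHS]big1 => [|g _].
  by move/eqP; rewrite -mulr_natr mulf_eq0 (negPf (cardG_neq0 R)) orbF.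
rewrite -(reindex_inj (P := xpredT) (F := centered_delta)
  (word_update_inj _ _ _ w1)).
exact: sum_centered_delta.
Qed.

(** Occurrences of a generator and of its inverse are counted together. *)
Definition no_singleton w := [forall i, count (fun j => j.1 == i) w != 1%N].

Lemma sum_walk_energy_le (R : realFieldType) m :
  \sum_g walk_energy g m
  <= #|[set w : (m + m).-tuple _ | no_singleton w]|%:R
     * #|{ffun 'I_k -> gT}|%:R :> R.
Proof.
under eq_bigr do rewrite walk_energyE.
rewrite exchange_big /= -natrM -sum_nat_const natr_sum [leRHS]big_mkcond /=.
apply: ler_sum => w _; rewrite inE; case: ifPn => [_|].
  rewrite -sum1_card natr_sum; apply: ler_sum => g _.
  apply: (@le_trans _ _ (word g w == 1%g)%:R).
    by rewrite gerBl invr_ge0.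
  by rewrite ler_nat leq_b1.
by rewrite negb_forall => /existsP[i /negPn/eqP /sum_word_singleton ->].
Qed.
End Walk.

(** * Counting the words in which no generator occurs exactly once *)

Section Count.
Context {k : nat}.
Implicit Types (w : seq ('I_k * bool)).

Lemma card_tuple_all (J : finType) (P : pred J) m :
  #|[set t : m.-tuple J | all P t]| = (#|P| ^ m)%N.
Proof.
rewrite -sum1dep_card big_mkcond /=.
elim: m => [|m IH].
  by rewrite (big_pred1 [tuple]) // => t; apply/esym/eqP; apply: tuple0.
rewrite (sum_cons_tuple _ _ _ (fun t => if all P t then 1%N else 0%N)) expnS.
rewrite -IH -sum1_card big_distrl [RHS]big_mkcond /=; apply: eq_bigr => j _.
rewrite [j \in P]/in_mem /=; case: (P j) => /=; first by rewrite mul1n.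
by rewrite big1.
Qed.

(** Every generator that occurs takes up at least two of the 2m positions. *)
Lemma card_no_singleton_le m w : no_singleton w -> size w = (m + m)%N ->
  (#|[set i | has (fun j => j.1 == i) w]| <= m)%N.
Proof.
move=> /forallP ns sz.
have cnt : (\sum_(i < k) count (fun j => j.1 == i) w = size w)%N.
  elim: w {ns sz} => [|j w IH] /=; first by rewrite big1.
  rewrite big_split /= IH (bigD1 j.1) //= eqxx big1 ?addn0 // => i.
  by rewrite eq_sym => /negPf ->.
suff : (#|[set i | has (fun j => j.1 == i) w]| * 2 <= m + m)%N by lia.
rewrite -sz -cnt -sum_nat_const big_mkcond /=; apply: leq_sum => i _.
by rewrite inE has_count; case: ltnP (ns i) => //; case: count => [|[]].
Qed.

(** Through the central binomial coefficient: m! m^m <= (2m)! = C(2m, m) m!^2 <= 4^m m!^2. *)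
Lemma expnn_le_fact m : (m ^ m <= 4 ^ m * m`!)%N.
Proof.
have H : (m`! * m ^ m <= (m + m)`!)%N.
  (* Only the exponent and the second summand vary: m! m^j <= (m + j)!. *)
  elim: {3 5}m => [|j IH]; first by rewrite muln1 addn0.
  rewrite addnS factS expnS mulnCA leq_mul // ; lia.
have C4 : ('C(m + m, m) <= 4 ^ m)%N.
  rewrite (_ : 4 = 2 ^ 2)%N // -expnM mul2n -addnn (Pascal 1 1).
  rewrite (bigD1 (inord m)) //= inordK ?ltnS ?leq_addr //.
  by rewrite !exp1n !muln1 leq_addr.
have := bin_fact (leq_addr m m); rewrite addnK => E.
rewrite -(leq_pmul2l (fact_gt0 m)) (leq_trans H) // -E mulnCA.
by rewrite !leq_mul.
Qed.

Lemma exists_superset_card (T : finType) (A : {set T}) m :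
  (#|A| <= m)%N -> (m <= #|T|)%N ->
  exists2 B : {set T}, #|B| == m & A \subset B.
Proof.
move=> Am mT; pose s := enum A ++ enum (~: A).
have us : uniq s.
  rewrite cat_uniq !enum_uniq andbT; apply/hasPn => x.
  by rewrite /= !mem_enum inE.
exists [set x in take m s].
  rewrite cardsE; move/card_uniqP: (take_uniq m us) => ->.
  by rewrite size_takel // size_cat -!cardE cardsC.
apply/subsetP => x xA; rewrite inE take_cat -cardE ltnNge Am /=.
by rewrite mem_cat mem_enum xA.
Qed.

(** The generators used lie in some set of exactly m indices, so the count is at most C(k, m)
    (2m)^(2m). Bounding one factor m^m by 4^m m! and C(k, m) m! by k^m gives the claim. *)
Lemma count_no_singleton m :
  (#|[set w : (m + m).-tuple ('I_k * bool) | no_singleton w]|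
   <= (16 * k * m) ^ m)%N.
Proof.
have cardP (T : {set 'I_k}) :
    #|(fun j : 'I_k * bool => j.1 \in T)| = (2 * #|T|)%N.
  rewrite -[RHS]mulnC -card_bool -cardsT -cardsX -[LHS]cardsE.
  by congr #|pred_of_set _|; apply/setP => j; rewrite !inE andbT.
(* For k < m there is no set of m indices, but the number (2k)^(2m) of all words is already small
   enough. *)
have [km|mk] := ltnP k m.
  apply: (leq_trans (max_card _)); rewrite card_tuple card_prod.
  rewrite card_ord card_bool.
  rewrite expnD -expnMn leq_exp2r; last by lia.
  by nia.
apply: (@leq_trans (\sum_(T : {set 'I_k} | #|T| == m)
  #|[set w : (m + m).-tuple ('I_k * bool) | all (fun j => j.1 \in T) w]|)).
  under eq_bigr do rewrite -sum1_card big_mkcond /=.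
  rewrite exchange_big -sum1_card big_mkcond /=; apply: leq_sum => w _.
  rewrite inE; case: ifP => // /card_no_singleton_le/(_ (size_tuple w)).
  rewrite -(card_ord k) in mk.
  move=> /exists_superset_card/(_ mk)[T Tm /subsetP sT].
  rewrite (bigD1 T) ?Tm //= inE; case: allP => // -[] j jw.
  by apply: sT; rewrite inE; apply/hasP; exists j.
under eq_bigr => T /eqP Tm do rewrite card_tuple_all cardP Tm.
rewrite sum_nat_const -[X in (X * _)%N]cardsE card_draws card_ord.
rewrite expnD !expnMn (_ : 16 = 4 * 4)%N // expnMn.
have e2 : (2 ^ m * 2 ^ m = 4 ^ m)%N by rewrite -expnMn.
have ff : (k ^_ m <= k ^ m)%N.
  by elim: (m) => // j IH; rewrite ffactnSr expnSr leq_mul ?leq_subr.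
have := leq_mul (leq_mul (leqnn 'C(k, m)) (expnn_le_fact m))
  (leqnn (4 ^ m * m ^ m)%N).
rewrite [('C(k, m) * (4 ^ m * _))%N]mulnCA bin_ffact => le1.
have := leq_mul ff (leqnn (4 ^ m * (4 ^ m * m ^ m))%N).
nia.
Qed.
End Count.

(** * The edge boundary as a quadratic form *)

Section Cut.
Context {R : realFieldType} {gT : finGroupType} {k : nat}.
Variables (g : {ffun 'I_k -> gT}) (S : {set gT}).

Local Notation n := (#|gT|%:R : R).
Local Notation s := (#|S|%:R : R).
Local Notation A := (adjacency g).

Definition indicator (x : gT) : R := (x \in S)%:R.

Definition centered_indicator (x : gT) : R := indicator x - s / n.

Local Notation v := centered_indicator.

Lemma sum_indicator : \sum_x indicator x = s.
Proof.
rewrite /indicator -sum1_card natr_sum [RHS]big_mkcond.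
by apply: eq_bigr => x _; case: ifP.
Qed.

Lemma sum_centered_indicator : \sum_x v x = 0.
Proof.
rewrite sumrB sum_indicator sumr_const -[_ / _ *+ _]mulr_natr.
by rewrite divfK ?subrr // cardG_neq0.
Qed.

Lemma centered_indicatorE x : v x = \sum_(y in S) centered_delta (x * y^-1)%g.
Proof.
rewrite sumrB sumr_const -[_^-1 *+ _]mulr_natl; congr (_ - _).
under eq_bigr do rewrite -eq_mulgV1.
rewrite /indicator; have [xS|xS] := boolP (x \in S).
  rewrite (bigD1 x) //= eqxx big1 ?addr0 // => y /andP[_ /negPf].
  by rewrite eq_sym => ->.
by rewrite big1 // => y yS; case: eqP => // xy; rewrite xy yS in xS.
Qed.

Lemma iter_adjacency_centered_indicator m x :
  iter m A v x = \sum_(y in S) iter m A centered_delta (x * y^-1)%g.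
Proof.
rewrite iter_adjacency.
under eq_bigr do rewrite centered_indicatorE.
rewrite exchange_big; apply: eq_bigr => y _; rewrite iter_adjacency.
by apply: eq_bigr => w _; rewrite mulgA.
Qed.

(** The iterate is a sum of |S| right translates of one function, all of the same norm.
    Cauchy-Schwarz over [S] gives one factor |S|, the sum of the norms the other. *)
Lemma iter_adjacency_le m :
  dot (iter m A v) (iter m A v) <= s ^+ 2 * walk_energy g m.
Proof.
apply: (@le_trans _ _ (\sum_x s * \sum_(y in S)
    iter m A centered_delta (x * y^-1)%g ^+ 2)).
  apply: ler_sum => x _; rewrite -expr2 iter_adjacency_centered_indicator.
  exact: sqr_sum_le_card.
rewrite -mulr_sumr expr2 -mulrA ler_wpM2l // exchange_big /=.
rewrite mulr_natl -sumr_const; apply: ler_sum => y _.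
rewrite le_eqVlt; apply/orP; left; apply/eqP.
rewrite /walk_energy /dot (reindex_inj (mulIg y)) /=.
by apply: eq_bigr => x _; rewrite mulgK expr2.
Qed.

Lemma dot_centered_indicator_le : dot v v <= s.
Proof.
have -> : dot v v = s - s ^+ 2 / n.
  transitivity (\sum_x (indicator x - s / n * indicator x - s / n * v x)).
    apply: eq_bigr => x _; rewrite /centered_indicator /indicator.
    by case: (x \in S) => /=; ring.
  rewrite sumrB sumrB -!mulr_sumr sum_centered_indicator sum_indicator; ring.
by rewrite gerBl divr_ge0 ?sqr_ge0.
Qed.

Lemma sum_letter_eq x : \sum_j (letter g j == x)%:R
  = (#|[set i | x == g i]| + #|[set i | x == (g i)^-1%g]|)%:R :> R.
Proof.
rewrite -(pair_bigA _ (fun i b => (letter g (i, b) == x)%:R)) /=.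
under eq_bigr do rewrite big_bool /= /letter /=.
rewrite big_split natrD; congr (_ + _).
all: rewrite -sum1dep_card natr_sum [RHS]big_mkcond /=; apply: eq_bigr => i _.
all: by rewrite eq_sym; case: eqP.
Qed.

Lemma adjacency_indicator x :
  A indicator x = (\sum_(u in S) cayley_graph g u x)%:R.
Proof.
rewrite natr_sum /=; under [RHS]eq_bigr do rewrite -sum_letter_eq.
rewrite exchange_big; apply: eq_bigr => j _; rewrite /indicator.
under eq_bigr do rewrite eq_mulgV1 invMg invgK mulgA -eq_mulgV1.
have [xS|xS] := boolP (_ \in S).
  rewrite (bigD1 (letter g j * x)%g) //= eqxx big1 ?addr0 // => u.
  move=> /andP[_ /negPf].
  by rewrite eq_sym => ->.
by rewrite big1 // => u uS; case: eqP => // xu; rewrite xu uS in xS.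
Qed.

(** By regularity the boundary is 2k|S| minus the form at the indicator. Constants are eigenvectors
    for 2k, so centering lowers the form by 2k|S|^2 / n. *)
Lemma edges_between_cayley :
  (edges_between (cayley_graph g) S (~: S))%:R
  = 2 * k%:R / n * s * (n - s) - dot v (A v).
Proof.
have sumA : \sum_x A indicator x = 2 * k%:R * s.
  rewrite exchange_big /=.
  under eq_bigr => j do rewrite
    -(reindex_inj (P := xpredT) (F := indicator) (mulgI (letter g j)))
    sum_indicator.
  rewrite sumr_const -[_ *+ #|_|]mulr_natl; congr (_ * _).
  by rewrite card_prod card_ord card_bool mulnC natrM.
have Av x : A v x = A indicator x - 2 * k%:R * (s / n).
  rewrite /adjacency sumrB sumr_const -[_ *+ #|_|]mulr_natl.
  by rewrite card_prod card_ord card_bool mulnC natrM.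
have dotA : dot v (A v) = dot indicator (A indicator) - 2 * k%:R * s ^+ 2 / n.
  transitivity (\sum_x (indicator x * A indicator x - s / n * A indicator x
      - 2 * k%:R * (s / n) * v x)).
    by apply: eq_bigr => x _; rewrite Av /centered_indicator; ring.
  rewrite sumrB sumrB -!mulr_sumr sum_centered_indicator sumA /dot; ring.
have inner : dot indicator (A indicator)
    = (\sum_(x in S) \sum_(u in S) cayley_graph g x u)%:R.
  rewrite /dot natr_sum [RHS]big_mkcond; apply: eq_bigr => x _.
  rewrite adjacency_indicator /indicator.
  case: ifP => _; rewrite ?mul0r ?mul1r //.
  by congr (_%:R); apply: eq_bigr => u _; apply: edge_multC.
have total : (edges_between (cayley_graph g) S (~: S)
    + \sum_(x in S) \sum_(u in S) cayley_graph g x u = #|S| * (2 * k))%N.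
  rewrite -big_split /= -sum_nat_const; apply: eq_bigr => x _.
  rewrite -(cayley_regular g x) [RHS](bigID (mem S)) /= addnC; congr (_ + _)%N.
  by apply: eq_bigl => u; rewrite inE.
move/(congr1 (fun a => a%:R : R)): total.
rewrite natrD natrM natrM dotA -inner => total.
have -> : (edges_between (cayley_graph g) S (~: S))%:R
  = s * (2 * k%:R) - dot indicator (A indicator) by rewrite -total addrK.
by field; apply: cardG_neq0.
Qed.

(** The moment bound leaves one surplus factor |S|; it is at most 2^m, which turns 48 into 96 after
    the m-th root. *)
Lemma cut_deviation_sqr_le m :
  (0 < #|S|)%N -> (#|S| <= 2 ^ m)%N -> (0 < m)%N ->
  walk_energy g m <= (48 * k%:R * m%:R) ^+ m :> R ->
  dot v (A v) ^+ 2 <= 96 * k%:R * m%:R * s ^+ 2.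
Proof.
move=> s0 s2m; case: m s2m => // m s2m _ Km.
rewrite -(ler_pXn2r (ltn0Sn m)) ?nnegrE ?sqr_ge0 ?mulr_ge0 //.
rewrite -exprM.
apply: (le_trans (dot_selfadjoint_pow _ _ _ (adjacency_sym R g) v m)).
apply: (@le_trans _ _ (s ^+ (2 * m).+1 *
    (s ^+ 2 * (48 * k%:R * m.+1%:R) ^+ m.+1))).
  rewrite ler_pM ?exprn_ge0 ?dot_ge0 //.
    by rewrite lerXn2r ?nnegrE ?dot_ge0 // dot_centered_indicator_le.
  by apply: (le_trans (iter_adjacency_le _)); rewrite ler_wpM2l ?sqr_ge0.
have -> : (96 * k%:R * m.+1%:R * s ^+ 2) ^+ m.+1 =
   s ^+ (2 * m.+1) * 2 ^+ m.+1 * (48 * k%:R * m.+1%:R) ^+ m.+1 :> R.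
  rewrite exprM -!exprMn; congr (_ ^+ _); ring.
rewrite mulrA ler_wpM2r ?exprn_ge0 ?mulr_ge0 // -exprD.
rewrite (_ : (2 * m).+1 + 2 = (2 * m.+1).+1)%N; last by lia.
by rewrite exprSr ler_wpM2l ?exprn_ge0 // -natrX ler_nat.
Qed.
End Cut.

(** * Markov's inequality and the union bound over exponents *)

Lemma markov_count (R : realFieldType) (T : finType) (F : T -> R) (a b : R) :
  0 < b -> (forall t, 0 <= F t) -> \sum_t F t <= a * #|T|%:R ->
  #|[set t | b < F t]|%:R <= a / b * #|T|%:R.
Proof.
move=> b0 F0 sumF; rewrite mulrAC ler_pdivlMr // (le_trans _ sumF) //.
rewrite -sum1dep_card natr_sum mulr_suml big_mkcond /=; apply: ler_sum => t _.
by case: ifP => [/ltW|_]; rewrite ?mul1r.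
Qed.

Lemma sum_inv3 (R : realFieldType) n :
  \sum_(m < n) 3 ^- m.+1 = (1 - 3 ^- n) / 2 :> R.
Proof.
elim: n => [|n IH]; first by rewrite big_ord0 expr0 invr1 subrr mul0r.
by rewrite big_ord_recr /= IH exprS invfM; lra.
Qed.

Lemma half_walk_energy_small (R : realFieldType) (gT : finGroupType)
    (k n : nat) :
  (0 < k)%N ->
  1 / 2 * #|{ffun 'I_k -> gT}|%:R
  <= #|[set g : {ffun 'I_k -> gT} | [forall m : 'I_n,
       walk_energy g m.+1 <= (48 * k%:R * m.+1%:R) ^+ m.+1 :> R]]|%:R :> R.
Proof.
move=> k0; pose T : finType := {ffun 'I_k -> gT}; rewrite -/T.
set good := [set g | _].
pose bad (m : 'I_n) := [set g : T |
  (48 * k%:R * m.+1%:R) ^+ m.+1 < walk_energy g m.+1 :> R].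
(* The threshold is 3^(m+1) times the bound on the mean, so the failure probabilities sum to less
   than 1/2. *)
have bad_le m : #|bad m|%:R <= 3 ^- m.+1 * #|T|%:R :> R.
  have b0 : 0 < (16 * k%:R * m.+1%:R) ^+ m.+1 :> R.
    by rewrite exprn_gt0 // !mulr_gt0 ?ltr0n.
  have -> : 3 ^- m.+1 = (16 * k%:R * m.+1%:R) ^+ m.+1 /
      (48 * k%:R * m.+1%:R) ^+ m.+1 :> R.
    have -> : 48 * k%:R * m.+1%:R = 3 * (16 * k%:R * m.+1%:R) :> R by ring.
    by rewrite [(3 * _) ^+ _]exprMn invfM mulrCA divff ?mulr1 // gt_eqF.
  apply: markov_count => [|g|]; first by rewrite exprn_gt0 // !mulr_gt0 ?ltr0n.
    exact: dot_ge0.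
  apply: (le_trans (sum_walk_energy_le R m.+1)); rewrite ler_wpM2r //.
  by rewrite -!natrM -natrX ler_nat count_no_singleton.
have cover : (#|T| <= #|good| + \sum_m #|bad m|)%N.
  rewrite -(cardsC good) leq_add2l.
  under eq_bigr do rewrite -sum1dep_card big_mkcond.
  rewrite exchange_big -sum1_card big_mkcond /=; apply: leq_sum => g _.
  rewrite !inE negb_forall; case: existsP => // -[m]; rewrite -ltNge => Km.
  by rewrite (bigD1 m) //= Km.
have : #|T|%:R <= #|good|%:R + \sum_m #|bad m|%:R :> R.
  by rewrite -natr_sum -natrD ler_nat.
have : \sum_m #|bad m|%:R <= 1 / 2 * #|T|%:R :> R.
  apply: (le_trans (ler_sum _ (fun m _ => bad_le m))).
  rewrite -mulr_suml sum_inv3 ler_wpM2r // ler_pM2r ?invr_gt0 //.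
  by rewrite gerBl invr_ge0 exprn_ge0.
lra.
Qed.

(** * Choice of the exponent and conclusion *)

Lemma up_log_le_ln (R : realType) s : (2 <= s)%N ->
  (up_log 2 s)%:R <= 4 * ln s%:R :> R.
Proof.
move=> s2; have s0 : 0 < s%:R :> R by rewrite ltr0n; lia.
(* From ln (1 + x) <= x at x = -1/2. *)
have ln2 : 1 / 2 <= ln 2 :> R.
  have := @le_ln1Dx R (- (1 / 2)).
  have -> : 1 + - (1 / 2) = 2^-1 :> R by field.
  rewrite lnV ?qualifE //=; lra.
(* Rounding up costs a factor 2, which is at most [s]. *)
have pow : (2 ^ up_log 2 s <= s ^ 2)%N.
  have := @up_log_gtn 2 s isT s2.
  have : (0 < up_log 2 s)%N by rewrite up_log_gt0.
  case: up_log => //= m; rewrite !expnS expn0 muln1 => _ /ltnW.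
  exact: leq_mul.
have : ln (2 ^+ up_log 2 s) <= ln (s%:R ^+ 2) :> R.
  by rewrite ler_ln ?qualifE /= ?exprn_gt0 // -!natrX ler_nat.
rewrite !lnXn // -(mulr_natr (ln 2)) -(mulr_natr (ln s%:R)) => le.
have : (1 / 2) * (up_log 2 s)%:R <= ln 2 * (up_log 2 s)%:R :> R.
  by rewrite ler_wpM2r.
lra.
Qed.

Theorem theorem1p2 (R : realType) :
  exists c : R, 0 < c /\
    forall (gT : finGroupType) (n : nat) (eps : R) (k : nat),
      abelian [set: gT] -> #|gT| = n ->
      0 < eps ->
      c * ln n%:R / eps ^+ 2 <= k%:R ->
      1 / 2 <= uniform_pr R
        [set g : {ffun 'I_k -> gT} |
          [forall S : {set gT},
            (2 <= #|S|)%N && (#|S|%:R <= n%:R / 2 :> R) ==>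
            (`| (edges_between (cayley_graph g) S (~: S))%:R /
                (2 * k%:R / n%:R * #|S|%:R * (n%:R - #|S|%:R)) - 1 |
             <= eps * Num.sqrt (ln #|S|%:R / ln n%:R))]].
Proof.
(* 384 = 96 * 4, from [cut_deviation_sqr_le] and [up_log_le_ln]. *)
exists 384; split=> // gT n eps k _ gTn eps0 hk.
have T0 : 0 < #|{ffun 'I_k -> gT}|%:R :> R.
  by rewrite ltr0n; apply/card_gt0P; exists [ffun=> 1%g].
rewrite /uniform_pr ler_pdivlMr //.
(* For n <= 1 no set [S] has two elements; otherwise ln n is positive and may be divided by. *)
have [n1|n1] := leqP n 1.
  set E := [set g | _]; have -> : E = [set: _].
    apply/setP => g; rewrite !inE; apply/forallP => S.
    apply/implyP => /andP[S2].
    by have := subset_leq_card (subsetT S); rewrite cardsT gTn; lia.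
  rewrite cardsT; lra.
have lnn : 0 < ln n%:R :> R by rewrite ln_gt0 // ltr1n.
have k0 : (0 < k)%N.
  by rewrite -(ltr0n R) (lt_le_trans _ hk) // divr_gt0 ?mulr_gt0 ?exprn_gt0.
apply: (le_trans (half_walk_energy_small R gT k n k0)).
rewrite ler_nat; apply/subset_leq_card/subsetP => g.
rewrite !inE => /forallP small.
apply/forallP => S; apply/implyP => /andP[S2 Sn].
set m := up_log 2 #|S|.
set D := dot (centered_indicator S) (adjacency g (centered_indicator S)) : R.
have m0 : (0 < m)%N by rewrite up_log_gt0.
(* The exponent lies within the range 1, ..., n controlled by the good event. *)
have mn : (m.-1 < n)%N.
  have mS : (2 ^ m.-1 < #|S|)%N by apply: up_log_gtn.
  have := subset_leq_card (subsetT S); rewrite cardsT gTn.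
  have := ltn_expl m.-1 (isT : 1 < 2)%N.
  by move: mS; lia.
have D2 : D ^+ 2 <= 96 * k%:R * m%:R * #|S|%:R ^+ 2.
  apply: cut_deviation_sqr_le => //; [exact: ltnW | exact: up_logP |].
  by have := small (Ordinal mn); rewrite /= prednK.
rewrite edges_between_cayley gTn -/D.
have s0 : 0 < #|S|%:R :> R by rewrite ltr0n ltnW.
have kR : 0 < k%:R :> R by rewrite ltr0n.
have nR : 0 < n%:R :> R by rewrite ltr0n ltnW.
have half : n%:R / 2 <= n%:R - #|S|%:R :> R by lra.
have ns0 : 0 < n%:R - #|S|%:R :> R by lra.
set w := 2 * k%:R / n%:R * #|S|%:R * (n%:R - #|S|%:R).
(* Here |S| <= n/2 enters, through n - |S| >= n/2. *)
have w0 : k%:R * #|S|%:R <= w.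
  have -> : w = 2 / n%:R * (n%:R - #|S|%:R) * (k%:R * #|S|%:R).
    by rewrite /w; ring.
  rewrite ler_peMl ?mulr_ge0 // mulrAC ler_pdivlMr //; lra.
have w1 : 0 < w by apply: lt_le_trans w0; rewrite mulr_gt0.
rewrite mulrBl divff ?gt_eqF // addrC addKr normrN.
(* Both sides become square roots, so that [D2] can be applied to the squares. *)
rewrite -sqrtr_sqr -[eps]gtr0_norm // -sqrtr_sqr -sqrtrM ?sqr_ge0 //.
rewrite ler_wsqrtr //.
have lns : m%:R <= 4 * ln #|S|%:R :> R by apply: up_log_le_ln.
rewrite mulrA ler_pdivlMr // [(D / w) ^+ 2]exprMn exprVn.
rewrite mulrAC ler_pdivrMr ?exprn_gt0 //.
have w2 : (k%:R * #|S|%:R) ^+ 2 <= w ^+ 2.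
  by rewrite lerXn2r ?nnegrE ?(ltW w1) // mulr_ge0.
have lnS : 0 <= ln #|S|%:R :> R by rewrite ln_ge0 // ler1n ltnW.
have hk' : 384 * ln n%:R <= k%:R * eps ^+ 2.
  by rewrite -ler_pdivrMr // exprn_gt0.
apply: (@le_trans _ _ (96 * k%:R * (4 * ln #|S|%:R) * #|S|%:R ^+ 2 * ln n%:R)).
  rewrite ler_wpM2r ?(ltW lnn) // (le_trans D2) // ler_wpM2r ?sqr_ge0 //.
  rewrite ler_wpM2l //.
  by rewrite mulr_ge0.
apply: (@le_trans _ _ (eps ^+ 2 * ln #|S|%:R * (k%:R * #|S|%:R) ^+ 2));
  last first.
  by rewrite ler_wpM2l // mulr_ge0 ?sqr_ge0.
have -> : 96 * k%:R * (4 * ln #|S|%:R) * #|S|%:R ^+ 2 * ln n%:R =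
   (k%:R * ln #|S|%:R * #|S|%:R ^+ 2) * (384 * ln n%:R) :> R by ring.
have -> : eps ^+ 2 * ln #|S|%:R * (k%:R * #|S|%:R) ^+ 2 =
   (k%:R * ln #|S|%:R * #|S|%:R ^+ 2) * (k%:R * eps ^+ 2) :> R by ring.
by rewrite ler_wpM2l // mulr_ge0 ?mulr_ge0 ?sqr_ge0.
Qed.
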